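(* Let $R$ be a commutative ring with identity and let $M$ be an $R$-module. If $M$ is a comorphic $R$-module, then every finite sum $L_1+\cdots+L_n$ ($n\ge 1$) of completely irreducible submodules $L_1,\dots,L_n$ of $M$ is a completely irreducible submodule of $M$.
   Context: A proper submodule $N$ of an $R$-module $M$ is completely irreducible if whenever $N=\bigcap_{i\in I}N_i$ for a family $\{N_i\}_{i\in I}$ of submodules of $M$, then $N=N_i$ for some $i\in I$. For a submodule $N$ of $M$, $(N:_RM)=\{r\in R: rM\subseteq N\}$, and $\mathrm{Ann}_R(M)=\{r\in R: rM=0\}$. An $R$-module $M$ is comorphic if for each completely irreducible submodule $L$ of $M$ there exists $a\in R$ such that $L=aM$ and $(L:_RM)=Ra+\mathrm{Ann}_R(M)$.
   Formalization: The sum L_1+...+L_n is additionally assumed to be a proper submodule of M; without this the claim fails, e.g. for the comorphic Z-module M = Z/6, where 2M and 3M are completely irreducible but 2M+3M = M is not proper. *)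

(* Defs.v *)
From HB Require Import structures.
From mathcomp Require Import all_boot all_algebra.
From mathcomp Require Import boolp classical_sets.

Set Implicit Arguments.
Unset Strict Implicit.
Unset Printing Implicit Defensive.

Import GRing.Theory.
Local Open Scope classical_set_scope.
Local Open Scope ring_scope.

Section Submodules.
Context {R : comPzRingType} {M : lmodType R}.
Implicit Types (N L : set M).

Definition submodule N : Prop := submod_closed (mem N).

(* The index type may be empty; the intersection is then [setT], which the
   properness of [N] already excludes.  Properness is not preserved by sums:
   in the comorphic Z-module Z/6, the submodules 2M and 3M are completely
   irreducible and 2M + 3M = M. *)
Definition completely_irreducible N : Prop :=
  [/\ submodule N, N <> setT &
      forall (I : Type) (F : I -> set M), (forall i, submodule (F i)) ->
        N = \bigcap_i F i -> exists i, N = F i].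

Definition colon N : set R := [set r | forall x : M, N (r *: x)].

Definition scaled (a : R) : set M := [set a *: x | x in setT].

Definition submodule_sum (n : nat) (L : 'I_n -> set M) : set M :=
  [set \sum_(i < n) x i | x in [set x : 'I_n -> M | forall i, L i (x i)]].

End Submodules.

Definition annihilator {R : comPzRingType} (M : lmodType R) : set R :=
  [set r | forall x : M, r *: x = 0].

Definition comorphic {R : comPzRingType} (M : lmodType R) : Prop :=
  forall L : set M, completely_irreducible L ->
    exists a : R, L = scaled a /\
      colon L = [set r * a + s | r in setT & s in annihilator M].

(* Main.v *)
Require Import Defs.
From mathcomp Require Import all_boot all_algebra.
From mathcomp Require Import boolp classical_sets.

(** The point is that two completely irreducible submodules [L1 = aM] and
    [L2 = bM] contained in a common proper submodule are comparable, so that a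
    proper finite sum is just its largest summand.

    Suppose they are incomparable.  If multiplication by [b] were not injective
    on [M/L1], then [(L1 : b) = cM] and [(L1 : c) = dM] would be completely
    irreducible, with [b = e d] up to the annihilator.  Then [e] is injective on
    [dM/L1], hence on [M/L1], so the intersection of [eM] and [dM] is [e dM = L2];
    as [L2] is irreducible, it equals [eM] or [dM], and either is impossible.  So
    [b] is injective on [M/L1], and symmetrically [a] on [M/L2].

    Let [dM] be a completely irreducible submodule containing both.  As [d]
    divides [b], it is injective on [M/L1]; writing [a = a' d] this forces
    [a' M <= aM], so [a = t a d] and [a] kills [(1 - t d) M], which therefore lies
    in [L2 <= dM]: thus [M = dM], which is absurd. *)

Section CompletelyIrreducible.
Import GRing.Theory.
Local Open Scope classical_set_scope.
Local Open Scope ring_scope.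
Context {R : comPzRingType} {M : lmodType R}.
Implicit Types (N L K : set M) (a b r : R).

(** * Closure properties of submodules *)

Lemma scalerC a b (x : M) : a *: (b *: x) = b *: (a *: x).
Proof. by rewrite !scalerA mulrC. Qed.

Lemma submoduleP N :
  submodule N <->
  N 0 /\ forall r (x y : M), N x -> N y -> N (r *: x + y).
Proof.
split=> [[N0 Nl]|[N0 Nl]]; split; first by move: N0; rewrite inE.
- move=> r x y Nx Ny.
  by have := Nl r x y (mem_set Nx) (mem_set Ny); rewrite inE.
- by rewrite inE.
- by move=> r x y /set_mem Nx /set_mem Ny; apply/mem_set/Nl.
Qed.

Lemma submodule0 N : submodule N -> N 0.
Proof. by case/submoduleP. Qed.

Lemma submoduleD N x y : submodule N -> N x -> N y -> N (x + y).
Proof. by case/submoduleP=> _ Nl Nx Ny; rewrite -[x]scale1r; apply: Nl. Qed.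

Lemma submoduleZ N r x : submodule N -> N x -> N (r *: x).
Proof. by case/submoduleP=> N0 Nl Nx; rewrite -[_ *: _]addr0; apply: Nl. Qed.

Lemma submoduleB N x y : submodule N -> N x -> N y -> N (x - y).
Proof.
by move=> sN Nx Ny; rewrite -scaleN1r; apply: submoduleD => //; apply: submoduleZ.
Qed.

Lemma submodule_preimage r L :
  submodule L -> submodule [set y | L (r *: y)].
Proof.
move=> sL; apply/submoduleP; split=> [|s x y /= Lx Ly] /=.
  by rewrite scaler0; apply: submodule0.
by rewrite scalerDr scalerC; apply: submoduleD => //; apply: submoduleZ.
Qed.

(** This is [r N + L], the preimage of the image of [r N] in [M/L]. *)
Lemma submodule_scaled_add r N L : submodule N -> submodule L ->
  submodule [set z | exists2 n, N n & L (z - r *: n)].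
Proof.
move=> sN sL; apply/submoduleP; split=> [|s x y /= [n Nn Ln] [m Nm Lm]] /=.
  by exists 0; rewrite ?scaler0 ?subr0; apply: submodule0.
exists (s *: n + m); first by apply: submoduleD => //; apply: submoduleZ.
rewrite scalerDr scalerC opprD addrACA -scalerBr.
by apply: submoduleD => //; apply: submoduleZ.
Qed.

Lemma submodule_scaled r : submodule (scaled r : set M).
Proof.
apply/submoduleP; split=> [|s _ _ [x _ <-] [y _ <-]].
  by exists 0; rewrite ?scaler0.
by exists (s *: x + y) => //; rewrite scalerDr scalerC.
Qed.

(** * Completely irreducible submodules *)

(* [x] generates the essential simple socle of [M/L]. *)
Lemma completely_irreducibleP L :
  completely_irreducible L <->
  submodule L /\ exists2 x, ~ L x &
    forall N, submodule N -> L `<=` N -> ~ N `<=` L -> N x.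
Proof.
split=> [[sL _ irrL]|[sL [x Lx Nx]]].
  split=> //; apply: contrapT => /forall2NP noX.
  (* If no [x] works, the submodules strictly containing [L] intersect in [L]. *)
  pose J := {N : set M | [/\ submodule N, L `<=` N & ~ N `<=` L]}.
  have [] := irrL J (fun i => sval i).
  - by move=> [N []].
  - rewrite eqEsubset; split=> [x Lx [N [? LN ?]] _|x capx] /=; first exact: LN.
    apply: contrapT => Lx; have [//|] := noX x; apply=> N sN LN NL.
    exact: (capx (exist _ N (And3 sN LN NL)) I).
  - by move=> [N [sN LN NL]] /= eLN; apply: NL; rewrite -eLN.
split=> // [LT|I F sF LF]; first by apply: Lx; rewrite LT.
apply: contrapT => /forallNP nF; apply: Lx; rewrite LF => i _.
apply: Nx => //; first by rewrite LF => y; apply.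
move=> FL; apply: (nF i); rewrite eqEsubset; split=> //.
by rewrite LF => y; apply.
Qed.

Lemma completely_irreducible_submodule L :
  completely_irreducible L -> submodule L.
Proof. by case. Qed.

(** If neither [N] nor [K] lay in [L], both would contain the socle generator [x], hence so would
    [L]. *)
Lemma completely_irreducible_irreducible L N K :
  completely_irreducible L -> submodule N -> submodule K ->
  L `<=` N -> L `<=` K -> N `&` K `<=` L -> N `<=` L \/ K `<=` L.
Proof.
move=> /completely_irreducibleP[_ [x Lx Px]] sN sK LN LK NKL.
case: (pselect (N `<=` L)) => [|nN]; first by left.
case: (pselect (K `<=` L)) => [|nK]; first by right.
by case: Lx; apply: NKL; split; apply: Px.
Qed.

(* The image of multiplication by [r] identifies [M/(L : r)] with a nonzero
   submodule of [M/L], whose socle it therefore shares. *)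
Lemma completely_irreducible_preimage L r :
  completely_irreducible L -> ~ (forall y, L (r *: y)) ->
  completely_irreducible [set y | L (r *: y)].
Proof.
move=> ciL rL; have sL := completely_irreducible_submodule _ ciL.
have /completely_irreducibleP[_ [x Lx Px]] := ciL.
have socle N : submodule N -> ~ (forall y, N y -> L (r *: y)) ->
    exists2 n, N n & L (x - r *: n).
  move=> sN NL; apply: (Px _ (submodule_scaled_add r _ _ sN sL)).
    move=> y Ly /=; exists 0; first exact: submodule0.
    by rewrite scaler0 subr0.
  move=> sub; apply: NL => n Nn; apply: sub => /=; exists n => //.
  by rewrite subrr; apply: submodule0.
have sT : submodule (@setT M) by apply/submoduleP.
(* A preimage [y] of [x] under [r] modulo [L] generates the socle of [M/(L : r)]. *)
have [y _ Ly] : exists2 y : M, setT y & L (x - r *: y).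
  by apply: socle => // yL; apply: rL => z; apply: yL.
apply/completely_irreducibleP; split; first exact: submodule_preimage.
exists y => [/= ryL|N sN LN NL].
  by apply: Lx; rewrite -[x](subrK (r *: y)); apply: submoduleD.
have [n Nn Ln] := socle N sN NL.
rewrite -[y](subrK n); apply: submoduleD => //; apply: LN => /=.
rewrite (_ : _ *: _ = (x - r *: n) - (x - r *: y)); first exact: submoduleB.
by rewrite scalerBr opprB [RHS]addrC addrA subrK.
Qed.

(** Take a submodule maximal among those containing [N] and avoiding a fixed [x] outside [N]: every
    strictly larger one contains [x]. *)
Lemma sub_completely_irreducible N : submodule N -> N <> setT ->
  exists2 L, completely_irreducible L & N `<=` L.
Proof.
move=> sN /eqP/setTPn[x Nx].
(* Unions with [N] make the empty chain harmless. *)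
pose P K := submodule (N `|` K) /\ ~ (N `|` K) x.
have [F FP totF|A [[sA Ax] maxA]] := @Zorn_bigcup M P.
  split; last first.
    by case=> // -[K FK Kx]; case: (FP K FK) => _; apply; right.
  apply/submoduleP; split=> [|r y z]; first by left; apply: submodule0.
  have inc K w : F K -> (N `|` K) w -> (N `|` \bigcup_(X in F) X) w.
    by move=> FK [Nw|Kw]; [left|right; exists K].
  have incl K : F K -> (N `|` K) y -> (N `|` K) z ->
      (N `|` \bigcup_(X in F) X) (r *: y + z).
    move=> FK Ky Kz; apply: (inc K) => //.
    by have [sK _] := FP K FK; apply: submoduleD => //; apply: submoduleZ.
  case=> [Ny|[K FK Ky]] [Nz|[K' FK' Kz]].
  - by left; apply: submoduleD => //; apply: submoduleZ.
  - by apply: (incl K'); [|left|right].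
  - by apply: (incl K); [|right|left].
  - have [KK'|K'K] := totF K K' FK FK'.
      by apply: (incl K'); [|right; apply: KK'|right].
    by apply: (incl K); [|right|right; apply: K'K].
exists (N `|` A); last by move=> y Ny; left.
apply/completely_irreducibleP; split=> //; exists x => // K sK AK KA.
apply: contrapT => Kx; apply: (maxA K).
  by split=> [y Ay|KA']; [apply: AK; right|apply: KA => y /KA'; right].
have NK : N `|` K = K by apply/setUidPr => y Ny; apply: AK; left.
by rewrite /P NK.
Qed.

(** * Comparability in comorphic modules *)

Context (comM : comorphic M).

(** The annihilator part of the colon ideal acts as zero, so [r] acts on [M] as a multiple of
    [a]. *)
Lemma comorphic_generator L : completely_irreducible L ->
  exists2 a, L = scaled a &
    forall r, (forall y, L (r *: y)) ->
      exists t, forall y : M, r *: y = t *: (a *: y).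
Proof.
move=> /comM[a [La colL]]; exists a => // r rL.
have : colon L r by [].
rewrite colL => -[t _ [s sM <-]]; exists t => y.
by rewrite scalerDl sM addr0 scalerA.
Qed.

Lemma incomparable_scaled_inj L1 b :
  completely_irreducible L1 -> completely_irreducible (scaled b : set M) ->
  ~ L1 `<=` scaled b -> ~ scaled b `<=` L1 ->
  forall y, L1 (b *: y) -> L1 y.
Proof.
move=> ci1 ci2 n12 n21; apply: contrapT => ninj.
have s1 := completely_irreducible_submodule _ ci1.
have ciK : completely_irreducible [set y | L1 (b *: y)].
  apply: completely_irreducible_preimage => // bL; apply: n21.
  by move=> _ [y _ <-].
have [c Kc _] := comorphic_generator _ ciK.
have bc y : L1 (b *: (c *: y)).
  have : (scaled c : set M) (c *: y) by exists y.
  by rewrite -Kc.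
have ciD : completely_irreducible [set y | L1 (c *: y)].
  apply: completely_irreducible_preimage => // cL; apply: ninj => y.
  have -> : L1 (b *: y) = [set y | L1 (b *: y)] y by [].
  by rewrite Kc => -[z _ <-].
have [d Dd Dcol] := comorphic_generator _ ciD.
have sD := completely_irreducible_submodule _ ciD.
have LD : L1 `<=` [set y | L1 (c *: y)] by move=> y Ly; apply: submoduleZ.
have bD : (scaled b : set M) `<=` [set y | L1 (c *: y)].
  by move=> _ [y _ <-] /=; rewrite scalerC.
have [e be] : exists e, forall y : M, b *: y = e *: (d *: y).
  by apply: Dcol => y; apply: bD; exists y.
have cd y : L1 (c *: (d *: y)).
  have : (scaled d : set M) (d *: y) by exists y.
  by rewrite -Dd.
(* [(L1 : e)] and [dM] meet in [L1]: if [e d w = b w] lies in [L1], then [w] lies in [cM], and [d w]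
   in [d c M <= L1]. *)
have einj y : L1 (e *: y) -> L1 y.
  have [|||||eL|DL] // := completely_irreducible_irreducible L1
      [set y | L1 (e *: y)] [set y | L1 (c *: y)] ci1.
  - exact: submodule_preimage.
  - by move=> z Lz; apply: submoduleZ.
  - move=> z /= [ez]; have -> : L1 (c *: z) = [set y | L1 (c *: y)] z by [].
    rewrite Dd => -[w _ dw]; move: ez; rewrite -dw -be => bw.
    have : [set y | L1 (b *: y)] w by [].
    by rewrite Kc => -[v _ <-]; rewrite scalerC.
  - exact: eL.
  - by case: n21 => z /bD /DL.
(* Injectivity of [e] on [M/L1] passes to [M/dM], as [dM = (L1 : c)]. *)
have eD y : L1 (c *: (e *: y)) -> L1 (c *: y).
  by rewrite scalerC => /einj.
(* If [e y] lies in [dM], then [y = d z] and [e y = b z]: so [eM] and [dM] meet in [bM]. *)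
have [|||||eb|Db] // := completely_irreducible_irreducible (scaled b)
    (scaled e) [set y | L1 (c *: y)] ci2.
- exact: submodule_scaled.
- by move=> _ [y _ <-]; rewrite be; exists (d *: y).
- move=> _ [[y _ <-] /= /eD].
  have -> : L1 (c *: y) = [set y | L1 (c *: y)] y by [].
  by rewrite Dd => -[z _ <-]; rewrite -be; exists z.
(* If [eM <= bM <= dM], injectivity of [e] on [M/dM] forces [dM = M]. *)
- have [_ DT _] := ciD; apply: DT; rewrite eqEsubset; split=> // y _ /=.
  by apply: eD; apply/bD/eb; exists y.
- by apply: n12 => y /LD /Db.
Qed.

Lemma comorphic_comparable L1 L2 N :
  completely_irreducible L1 -> completely_irreducible L2 ->
  submodule N -> N <> setT -> L1 `<=` N -> L2 `<=` N ->
  L1 `<=` L2 \/ L2 `<=` L1.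
Proof.
move=> ci1 ci2 sN NT L1N L2N; case: (pselect (L1 `<=` L2)) => [|n12]; first by left.
right; apply: contrapT => n21.
have [D ciD ND] := sub_completely_irreducible _ sN NT.
have [a La acol] := comorphic_generator _ ci1.
have [b Lb _] := comorphic_generator _ ci2.
have [d Dd dcol] := comorphic_generator _ ciD.
have aL y : L1 (a *: y) by rewrite La; exists y.
have bL y : L2 (b *: y) by rewrite Lb; exists y.
have s1 := completely_irreducible_submodule _ ci1.
have sD := completely_irreducible_submodule _ ciD.
have binj y : L1 (b *: y) -> L1 y.
  by move: y; apply: incomparable_scaled_inj; rewrite -?Lb.
have ainj y : L2 (a *: y) -> L2 y.
  by move: y; apply: incomparable_scaled_inj; rewrite -?La.
have [a' aE] := dcol a (fun y => ND _ (L1N _ (aL y))).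
have [b' bE] := dcol b (fun y => ND _ (L2N _ (bL y))).
(* [b a' y = b' d a' y = b' a y] lies in [L1], hence so does [a' y]. *)
have [t tE] : exists t, forall y : M, a' *: y = t *: (a *: y).
  apply: acol => y; apply: binj; rewrite bE; apply: submoduleZ => //.
  by rewrite scalerC -aE.
have [_ DT _] := ciD; apply: DT; rewrite eqEsubset; split=> // y _.
rewrite -[y](subrK (d *: (t *: y))); apply: submoduleD => //; last first.
  by rewrite Dd; exists (t *: y).
apply/ND/L2N/ainj; rewrite scalerBr.
have -> : a *: y = a *: (d *: (t *: y)).
  by rewrite [LHS]aE tE scalerC [t *: _]scalerC.
by rewrite subrr; apply: submodule0 (completely_irreducible_submodule _ ci2).
Qed.

(** * Finite sums *)

Lemma submodule_submodule_sum n (L : 'I_n -> set M) :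
  (forall i, submodule (L i)) -> submodule (submodule_sum L).
Proof.
move=> sL; apply/submoduleP; split.
  by exists (fun=> 0); [move=> i; apply: submodule0|rewrite big1].
move=> r _ _ [x Lx <-] [y Ly <-]; exists (fun i => r *: x i + y i).
  by move=> i; apply: submoduleD => //; apply: submoduleZ.
by rewrite big_split /= scaler_sumr.
Qed.

Lemma sub_submodule_sum n (L : 'I_n -> set M) i :
  (forall i, submodule (L i)) -> L i `<=` submodule_sum L.
Proof.
move=> sL x Lx; exists (fun j => if j == i then x else 0).
  by move=> j; case: eqP => [->|_] //; apply: submodule0.
by rewrite -big_mkcond big_pred1_eq.
Qed.

Lemma submodule_sum_sub n (L : 'I_n -> set M) N :
  submodule N -> (forall i, L i `<=` N) -> submodule_sum L `<=` N.
Proof.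
move=> sN LN _ [x Lx <-]; apply: big_ind => [|y z|i _].
- exact: submodule0.
- exact: submoduleD.
- exact/LN/Lx.
Qed.

End CompletelyIrreducible.

Lemma ord_chain_max {T : Type} {n : nat} (L : 'I_n -> set T) : (0 < n)%N ->
  (forall i j, subset (L i) (L j) \/ subset (L j) (L i)) ->
  exists k, forall i, subset (L i) (L k).
Proof.
elim: n L => // -[|n] IH L _ tot.
  by exists ord0 => i; rewrite (ord1 i).
have [k kmax] := IH (fun i => L (lift ord0 i)) isT (fun i j => tot _ _).
have [L0k|Lk0] := tot ord0 (lift ord0 k).
  by exists (lift ord0 k) => i; case: (unliftP ord0 i) => [j|] ->.
exists ord0 => i; case: (unliftP ord0 i) => [j|] -> //.
exact: subset_trans (kmax j) Lk0.
Qed.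

Theorem corollary2p5 (R : comPzRingType) (M : lmodType R)
  (hM : comorphic M) (n : nat) (hn : (0 < n)%N) (L : 'I_n -> set M)
  (hL : forall i, completely_irreducible (L i))
  (hproper : submodule_sum L <> setT) :
  completely_irreducible (submodule_sum L).
Proof.
have sL i := completely_irreducible_submodule _ (hL i).
have [k kmax] : exists k, forall i, subset (L i) (L k).
  apply: ord_chain_max => // i j.
  (* The sum itself is the proper submodule containing both summands. *)
  apply: (comorphic_comparable hM _ _ (submodule_sum L)) => //.
  - exact: submodule_submodule_sum.
  - exact: sub_submodule_sum.
  - exact: sub_submodule_sum.
rewrite (_ : submodule_sum L = L k); first exact: hL.
rewrite eqEsubset; split; last exact: sub_submodule_sum.
exact: submodule_sum_sub.
Qed.
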